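(* Let $f:\mathbb{R}^d\to\mathbb{R}$ be a continuous non-linear function, and let $\Theta'$ be either the set $\{\theta\in\mathbb{R}^d: f(\theta)=0\}$ or the set $\{\theta\in\mathbb{R}^d: f(\theta)\le 0\}$. Assume that $\Theta'$ is bounded and is not a singleton. Let $P_\theta$, $\theta\in\Theta'$, be a collection of probability distributions on some measurable space $\mathcal{X}$ which are absolutely continuous with respect to one another, and let $\mathbf{X}\sim P_\theta$ be a random variable taking values in $\mathcal{X}$. Then there exists no unbiased estimator $g(\mathbf{X})$ for $\theta$ which is measurable with respect to the Lebesgue $\sigma$-algebra and whose range is $\Theta'$.
   Context: An estimator whose range is $\Theta'$ is a measurable function $g:\mathcal{X}\to\Theta'\subseteq\mathbb{R}^d$, i.e. all its values lie in $\Theta'$ (measurability is with respect to the Lebesgue $\sigma$-algebra on $\mathbb{R}^d$). It is unbiased if for every $\theta\in\Theta'$ the expectation exists and $\mathbb{E}_{P_\theta}(g(\mathbf{X}))=\int_{\mathcal{X}} g\,dP_\theta=\theta$. The distributions are absolutely continuous with respect to one another if any two of them have the same null sets. *)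

(* Defs.v *)
From HB Require Import structures.
From mathcomp Require Import all_boot all_order all_algebra.
From mathcomp Require Import all_classical all_reals all_analysis.
From mathcomp Require Import measurable_realfun.

Set Implicit Arguments.
Unset Strict Implicit.
Unset Printing Implicit Defensive.

Import Order.TTheory GRing.Theory Num.Theory.
Import numFieldNormedType.Exports.

Local Open Scope classical_set_scope.
Local Open Scope ring_scope.

Definition borelRn (R : realType) (d : nat) :=
  g_sigma_algebraType (@open 'rV[R]_d).

(* Lebesgue measure on the Borel subsets of R^d, as the d-fold product of the
   one-dimensional one: R^(n+1) is identified with R * R^n through
   (x, v) |-> row_mx x%:M v, and R^0 is a point of mass 1. Only its values on
   Borel sets are meaningful. *)
Fixpoint lebesgueRn (R : realType) (d : nat) : set (borelRn R d) -> \bar R :=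
  match d return set (borelRn R d) -> \bar R with
  | 0 => dirac (0 : borelRn R 0)
  | n.+1 => pushforward (@lebesgue_measure R \x @lebesgueRn R n)%E
              (fun p : measurableTypeR R * borelRn R n => row_mx p.1%:M p.2 : borelRn R n.+1)
  end.

Lemma lebesgueRn_set0 (R : realType) d : lebesgueRn (set0 : set (borelRn R d)) = 0%E.
Proof.
elim: d => [|d IH]; rewrite /= ?/pushforward /product_measure1 ?diracE ?in_set0//=.
by rewrite preimage_set0 integral0_eq// => x _ /=; rewrite xsection0.
Qed.

Lemma lebesgueRn_box (R : realType) d (a b : 'I_d -> R) :
  (forall i, a i <= b i) ->
  lebesgueRn [set v : borelRn R d | forall i, v 0 i \in `]a i, b i] ] =
  (\prod_i (b i - a i))%:E.
Proof.
elim: d a b => [|d IH] a b ab.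
  by rewrite /= big_ord0 diracE mem_set//= => -[].
rewrite /= /pushforward /product_measure1.
rewrite [LHS](_ : _ = (\int[@lebesgue_measure R]_x
    ((\prod_i (b (lift ord0 i) - a (lift ord0 i))%R)%:E * (\1_(`]a ord0, b ord0]%classic : set R) x)%:E))%E).
  rewrite integralZl//.
    have H := lebesgue_measure_itv `]a ord0, b ord0].
    rewrite integral_indic// setIT.
    rewrite [X in (_ * X)%E](_ : _ = (b ord0 - a ord0)%:E).
      by rewrite -EFinM mulrC big_ord_recl.
    apply: etrans H _; rewrite /= lte_fin; case: ltP => // ba.
    by rewrite (_ : b ord0 = a ord0) ?subrr//; apply/eqP; rewrite eq_le ba ab.
  apply: integrable_indic_itv => //.
apply: eq_integral => x _ /=.
rewrite indicE; case: (boolP (x \in _)) => xab.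
  rewrite mule1 -IH//; congr lebesgueRn; apply/seteqP; split => v /=.
    rewrite /xsection/= inE/= => H i; have := H (lift ord0 i).
    by rewrite mxE; case: splitP => [[[]]//|k /= /eqP];
      rewrite /bump /= eqSS => /eqP /val_inj ->.
  move=> H; rewrite /xsection/= inE/= => i; rewrite mxE; case: splitP => [j|k] E.
    rewrite (ord1 j) !mxE eqxx mulr1n; have -> : i = ord0.
      by apply/val_inj; rewrite /= E (ord1 j).
    by move: xab; rewrite inE.
  by have -> : i = lift ord0 k by apply/val_inj.
rewrite mule0 (_ : xsection _ _ = set0) //.
  exact: lebesgueRn_set0.
apply/seteqP; split => v //=; rewrite /xsection/= inE/= => H.
move/negP: xab; apply; rewrite inE/=.
have := H ord0; rewrite mxE; case: splitP => // j _; by rewrite (ord1 j) !mxE eqxx mulr1n.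
Qed.

(* R^d with its Lebesgue sigma-algebra: the completion of the Borel
   sigma-algebra with respect to Lebesgue measure. *)
Definition lebesgueRn_type (R : realType) (d : nat) :=
  g_sigma_algebraType (completed_algebra_gen (@lebesgueRn R d)).

Section estimators.
Context {dT : measure_display} {T : measurableType dT} {R : realType} {d : nat}.
Implicit Types (Theta : set 'rV[R]_d) (g : T -> 'rV[R]_d).

(* As for the range of an estimator in the statistical sense, all values are
   required to lie in Theta, but not every point of Theta has to be a value. *)
Definition estimator_with_range Theta g : Prop :=
  measurable_fun [set: T] (g : T -> lebesgueRn_type R d) /\
  (forall x, Theta (g x)).

(* The expectation of a vector is taken coordinatewise. *)
Definition unbiased Theta (P : Theta -> probability T R) g : Prop :=
  forall (theta : Theta) (i : 'I_d),
    (P theta).-integrable [set: T] (fun x => (g x ord0 i)%:E) /\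
    ('E_(P theta)[fun x => g x ord0 i] = (val theta ord0 i)%:E)%E.

End estimators.

(* Main.v *)
(* Theta is compact and nonempty, so it contains a point t of largest Euclidean
   norm. An estimator with values in Theta and mean t under P_t satisfies
   |g - t|^2 <= 2 <t, t - g>, whose right-hand side has expectation 0; hence
   g = t almost surely under P_t, therefore under every P_theta. Taking means
   under P_theta gives theta = t, so that Theta is the singleton {t}. *)
Require Import Defs.
From mathcomp Require Import all_boot all_order all_algebra.
From mathcomp Require Import all_classical all_reals all_analysis.
From mathcomp Require Import ring.
Import Order.TTheory GRing.Theory Num.Theory.
Import numFieldNormedType.Exports.
Local Open Scope classical_set_scope.
Local Open Scope ring_scope.

(** The norm carried by ['rV[R]_d] is the maximum norm, whose balls are not strictly convex. The
    argument needs the Euclidean norm, squared to keep it polynomial. *)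
Definition sqnorm {R : realType} {d : nat} (v : 'rV[R]_d) : R :=
  \sum_i v ord0 i ^+ 2.

Lemma sqnorm_continuous (R : realType) (d : nat) :
  continuous (@sqnorm R d).
Proof.
apply: (continuous_big add_continuous) => i _ v.
apply: (@continuous_comp _ _ _ (fun w : 'rV[R]_d => w ord0 i) (fun y => y ^+ 2)).
  exact: coord_continuous.
exact: exprn_continuous.
Qed.

Lemma sqnorm_eq0 {R : realType} {d : nat} (v : 'rV[R]_d) :
  sqnorm v = 0 -> v = 0.
Proof.
move=> /eqP; rewrite psumr_eq0 => [/allP v0|i _]; last exact: sqr_ge0.
apply/rowP => i; apply/eqP; rewrite mxE -sqrf_eq0.
by apply: v0; rewrite mem_index_enum.
Qed.

(** The right-hand side minus the left-hand side is exactly [sqnorm t - sqnorm v]. This is a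
    quantitative form of strict convexity of the ball at [t]. *)
Lemma sqnormB_le {R : realType} {d : nat} {v t : 'rV[R]_d} :
  sqnorm v <= sqnorm t ->
  sqnorm (v - t) <= 2 * \sum_i t ord0 i * (t ord0 i - v ord0 i).
Proof.
rewrite -subr_ge0 => vt; rewrite -subr_ge0.
suff -> : 2 * \sum_i t ord0 i * (t ord0 i - v ord0 i) - sqnorm (v - t) =
  sqnorm t - sqnorm v by [].
rewrite /sqnorm mulr_sumr -!sumrB; apply: eq_bigr => i _; rewrite !mxE; ring.
Qed.

(** Boundary points of a Euclidean ball are extreme, so a mean on the sphere leaves no room for
    spread inside the ball. *)
Lemma ae_eq_mean_of_sqnorm_le (R : realType) (d : nat) (dT : measure_display)
    (T : measurableType dT) (P : probability T R) (X : T -> 'rV[R]_d)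
    (t : 'rV[R]_d) :
  (forall i, P.-integrable [set: T] (fun x => (X x ord0 i)%:E)) ->
  (forall i, 'E_P[fun x => X x ord0 i] = (t ord0 i)%:E)%E ->
  (forall x, sqnorm (X x) <= sqnorm t) ->
  ae_eq P [set: T] X (cst t).
Proof.
move=> intX EX Xt.
pose h x := \sum_i t ord0 i * (t ord0 i - X x ord0 i).
have hE : EFin \o h = fun x =>
    (\sum_i (t ord0 i)%:E * ((t ord0 i)%:E - (X x ord0 i)%:E))%E.
  by apply/funext => x; rewrite /h /= -sumEFin.
have intB i : P.-integrable [set: T]
    (fun x => (t ord0 i)%:E - (X x ord0 i)%:E)%E.
  by apply: integrableB => //; exact: finite_measure_integrable_cst.
have inth : P.-integrable [set: T] (EFin \o h).
  by rewrite hE; apply: integrable_sum => // i _; exact: integrableZl.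
have h0 x : 0 <= h x.
  have := sqnormB_le (Xt x); rewrite -(@pmulr_rge0 _ 2)//.
  by apply: le_trans; apply: sumr_ge0 => i _; exact: sqr_ge0.
(* Since [h] is nonnegative, this is its plain integral. By linearity and [P setT = 1], the [i]-th
   term is [t_i * (t_i - E X_i)], which vanishes. *)
have : (\int[P]_x `|(EFin \o h) x| = 0)%E.
  rewrite (eq_integral (EFin \o h)); last first.
    by move=> x _; rewrite /= ger0_norm.
  rewrite hE integral_sum//; last by move=> i; exact: integrableZl.
  apply: big1 => i _; rewrite integralZl// integralB//; last first.
    exact: finite_measure_integrable_cst.
  rewrite integral_cst//= probability_setT mule1.
  by have := EX i; rewrite unlock => ->; rewrite subee// mule0.
move=> /ae_eq_integral_abs => /(_ measurableT (measurable_int _ inth)).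
apply: filterS => x /= /(_ I) [hx0] _.
(* Where [h x = 0], the squared distance from [X x] to [t] is squeezed between 0 and [2 * h x]. *)
apply/subr0_eq/sqnorm_eq0/le_anti.
rewrite sumr_ge0 ?andbT => [|i _]; last exact: sqr_ge0.
by apply: (le_trans (sqnormB_le (Xt x))); rewrite -/(h x) hx0 mulr0.
Qed.

Lemma exists_max_sqnorm {R : realType} {d : nat} {A : set 'rV[R]_d} :
  A !=set0 -> bounded_set A -> closed A ->
  exists2 t, A t & forall u, A u -> sqnorm u <= sqnorm t.
Proof.
move=> A0 Ab Ac.
have [|t At tmax] := EVT_max_rV A0 (bounded_closed_compact Ab Ac) (f := sqnorm).
  by apply: continuous_subspaceT; exact: sqnorm_continuous.
by exists t => [|u Au]; [rewrite -inE|apply: tmax; rewrite inE].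
Qed.

Theorem corollary1 (R : realType) (d : nat) (f : 'rV[R]_d -> R)
    (f_continuous : continuous f) (f_nonlinear : ~ scalar f)
    (Theta : set 'rV[R]_d)
    (Theta_def : Theta = [set theta | f theta = 0] \/
                 Theta = [set theta | f theta <= 0])
    (Theta_bounded : bounded_set Theta)
    (Theta_not_singleton : ~ exists theta0, Theta = [set theta0])
    (dT : measure_display) (T : measurableType dT)
    (P : Theta -> probability T R)
    (P_abs_continuous : forall theta1 theta2, P theta1 `<< P theta2) :
  ~ exists g : T -> 'rV[R]_d, estimator_with_range Theta g /\ unbiased P g.
Proof.
move=> [g [[_ gTheta] gE]].
have Theta_closed : closed Theta.
  have /continuous_closedP fcl := f_continuous.
  case: Theta_def => ->.
  - by apply: (fcl [set x | x = 0]).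
  - by apply: (fcl [set x | x <= 0]).
have [|t Thetat tmax] := exists_max_sqnorm (A := Theta) _ Theta_bounded Theta_closed.
  (* [T] is pointed, so the supposed estimator itself supplies an element of [Theta]. *)
  by exists (g point).
apply: Theta_not_singleton; exists t; apply/seteqP; split => [u Thetau|_ ->//].
pose theta0 : Theta := exist _ t (mem_set Thetat).
pose theta : Theta := exist _ u (mem_set Thetau).
have g_t : ae_eq (P theta) [set: T] g (cst t).
  (* The equality is proved under [P theta0], where [g] has mean [t], and passes to [P theta]
     because [P theta0]-null sets are [P theta]-null. *)
  apply: null_dominates_ae_eq (P_abs_continuous theta theta0) _ => //.
  apply: ae_eq_mean_of_sqnorm_le => [i|i|x].
  - exact: (gE theta0 i).1.
  - exact: (gE theta0 i).2.
  - exact: tmax.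
apply/rowP => i; have [intg] := gE theta i; rewrite unlock.
(* Under [P theta] the mean of the [i]-th coordinate is [u_i] by unbiasedness, and [t_i] because [g]
   is almost surely [t]. *)
rewrite (ae_eq_integral (cst (t ord0 i)%:E))//; last 2 first.
- exact: (measurable_int _ intg).
- by apply: filterS g_t => x /= gx Dx; rewrite gx.
by rewrite integral_cst//= probability_setT mule1 => -[].
Qed.
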